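(* Let $G$ be a Lie group in a Cartesian tangent category $(\mathbb X,\mathbb T)$. Then the Lie functor $\mathfrak g(-)$ of $G$ is representable, and it is represented by the tangent space $T_{\mathsf e}G$ at the unit; i.e. there is an isomorphism $\mathfrak g(A)\cong\mathbb X(A,T_{\mathsf e}G)$ natural in the object $A$.
   Context: Conventions. Composition is diagrammatic: $fg$ means first $f$, then $g$; $\langle f,g\rangle$ is pairing, $\pi_i$ are projections, $*$ is the terminal object and $!$ denotes maps to $*$. Tangent categories. A tangent structure $\mathbb T=(T,p,z,s,l,c)$ on a category $\mathbb X$ consists of an endofunctor $T$ and natural transformations $p_M:TM\to M$, $z_M:M\to TM$, $s_M:T_2M\to TM$, $l_M:TM\to TTM$, $c_M:TTM\to TTM$, where the $n$-fold pullback $T_nM$ of $p_M$ along itself exists and is preserved by all $T^k$, such that: $(p_M,z_M,s_M)$ is an additive bundle (a commutative monoid in $\mathbb X/M$); $(z_M,l_M):(p_M,z_M,s_M)\to(Tp_M,Tz_M,Ts_M)$ and $(\mathrm{id}_{TM},c_M):(p_{TM},z_{TM},s_{TM})\to(Tp_M,Tz_M,Ts_M)$ are additive bundle morphisms; $l_M\,Tl_M=l_M\,l_{TM}$, $c_Mc_M=\mathrm{id}$, $Tc_M\,c_{TM}\,Tc_M=c_{TM}\,Tc_M\,c_{TM}$, $l_Mc_M=l_M$, $l_{TM}\,Tc_M\,c_{TM}=c_M\,Tl_M$; and, with $\xi_M:=(z_{TM}\times l_M)\,Ts_M:T_2M\to TTM$, the square $\xi_M\,Tp_M=\pi_1p_Mz_M$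 exhibits $T_2M$ as the pullback of $Tp_M$ along $z_M$. It is Cartesian if $\mathbb X$ has finite products and $T$ preserves them (we identify $T(A\times B)=TA\times TB$). Lie groups. A group object $G$ has unit $\mathsf e:*\to G$, multiplication $\mathsf m_G$, inverse $\mathsf i_G$. It is a Lie group if the pullback $T_{\mathsf e}G$ of $p_G:TG\to G$ along $\mathsf e$ exists and is preserved by all $T^n$; $T_{\mathsf e}G$ is the tangent space at the unit. Lie functor. For an object $A$, an $A$-PLIVF ($A$-parametrized left-invariant vector field) on $G$ is a map $X:G\times A\to TG$ with $Xp_G=\pi_1$ and $(\mathsf m_G\times\mathrm{id}_A)X=(z_G\times X)\,T\mathsf m_G$ (maps $G\times G\times A\to TG$). $\mathfrak g(A)$ is the set of $A$-PLIVFs, and for $f:A\to B$, $\mathfrak g(f):\mathfrak g(B)\to\mathfrak g(A)$ is $X\mapsto(\mathrm{id}_G\times f)X$. This functor $\mathfrak g(-):\mathbb X^{\mathrm{op}}\to\mathbf{Set}$ is the Lie functor of $G$. *)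

(* Defs.v *)
From mathcomp Require Import all_boot.
From Stdlib Require Import FunctionalExtensionality ProofIrrelevance.

Set Implicit Arguments.
Unset Strict Implicit.
Unset Printing Implicit Defensive.

Declare Scope cat_scope.
Delimit Scope cat_scope with cat.
Local Open Scope cat_scope.

(* Composition is diagrammatic: [f \; g] is first [f], then [g].  Equality of
   morphisms is Leibniz equality. *)
Record category := Category {
  obj :> Type;
  hom : obj -> obj -> Type;
  idm : forall A, hom A A;
  compm : forall A B D, hom A B -> hom B D -> hom A D;
  compm1l : forall A B (f : hom A B), compm (idm A) f = f;
  compm1r : forall A B (f : hom A B), compm f (idm B) = f;
  compmA : forall A B D E (f : hom A B) (g : hom B D) (h : hom D E),
    compm f (compm g h) = compm (compm f g) h }.

Arguments hom {c} A B.
Arguments idm {c} A.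
Arguments compm {c A B D} f g.
Notation "f \; g" := (compm f g) : cat_scope.

Record functor (C D : category) := Functor {
  fobj :> C -> D;
  fmap : forall A B : C, hom A B -> hom (fobj A) (fobj B);
  fmap1 : forall A, fmap (idm A) = idm (fobj A);
  fmapM : forall A B E (f : hom A B) (g : hom B E),
    fmap (f \; g) = fmap f \; fmap g }.

Arguments fmap {C D} _ {A B} _.

Definition id_functor (C : category) : functor C C :=
  @Functor C C (fun A => A) (fun A B f => f) (fun _ => erefl)
    (fun _ _ _ _ _ => erefl).

Lemma comp_functor1 (C D E : category) (F : functor C D) (G : functor D E)
    (A : C) : fmap G (fmap F (idm A)) = idm (G (F A)).
Proof. by rewrite !fmap1. Qed.

Lemma comp_functorM (C D E : category) (F : functor C D) (G : functor D E)
    (A B A' : C) (f : hom A B) (g : hom B A') :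
  fmap G (fmap F (f \; g)) = fmap G (fmap F f) \; fmap G (fmap F g).
Proof. by rewrite !fmapM. Qed.

(* First [F], then [G]. *)
Definition comp_functor (C D E : category) (F : functor C D)
    (G : functor D E) : functor C E :=
  @Functor C E (fun A => G (F A)) (fun A B f => fmap G (fmap F f))
    (@comp_functor1 C D E F G) (@comp_functorM C D E F G).

Fixpoint iter_functor (C : category) (F : functor C C) (k : nat) :
    functor C C :=
  if k is k'.+1 then comp_functor (iter_functor F k') F else id_functor C.

Record nat_trans (C D : category) (F G : functor C D) := NatTrans {
  component :> forall A : C, hom (F A) (G A);
  naturality : forall (A B : C) (f : hom A B),
    fmap F f \; component B = component A \; fmap G f }.

Definition is_iso (C : category) (A B : C) (f : hom A B) : Prop :=
  exists g : hom B A, f \; g = idm A /\ g \; f = idm B.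

Record nat_iso (C D : category) (F G : functor C D) := NatIso {
  nat_iso_trans :> nat_trans F G;
  nat_iso_is_iso : forall A : C, is_iso (nat_iso_trans A) }.

Definition op_cat (C : category) : category :=
  @Category C (fun A B => hom B A) (fun A => idm A)
    (fun A B D f g => g \; f) (fun A B f => compm1r f) (fun A B f => compm1l f)
    (fun A B D E f g h => esym (compmA h g f)).

(* The category [Set] of sets and functions; sets are types. *)
Definition set_cat : category :=
  @Category Type (fun A B => A -> B) (fun A x => x) (fun A B D f g x => g (f x))
    (fun _ _ _ => erefl) (fun _ _ _ => erefl) (fun _ _ _ _ _ _ _ => erefl).

Definition presheaf (C : category) := functor (op_cat C) set_cat.

Section Representable.
Variables (C : category) (B : C).

Let homB (A : op_cat C) : set_cat := @hom C A B.

Let homB_map (A A' : op_cat C) (f : hom A A') : hom (homB A) (homB A') :=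
  fun g => (f : @hom C A' A) \; g.

Lemma hom_presheaf1 (A : op_cat C) : homB_map (idm A) = idm (homB A).
Proof. by apply: functional_extensionality => g; apply: compm1l. Qed.

Lemma hom_presheafM (A A' A'' : op_cat C) (f : hom A A') (g : hom A' A'') :
  homB_map (f \; g) = homB_map f \; homB_map g.
Proof. by apply: functional_extensionality => h; apply/esym/compmA. Qed.

Definition hom_presheaf : presheaf C := Functor hom_presheaf1 hom_presheafM.

End Representable.

Definition represented_by (C : category) (F : presheaf C) (B : C) : Prop :=
  inhabited (nat_iso F (hom_presheaf B)).

Definition representable (C : category) (F : presheaf C) : Prop :=
  exists B : C, represented_by F B.

(* The universal arrows are data; being unique, they carry no information
   beyond the universal property. *)

Record is_terminal (C : category) (Z : C) := IsTerminal {
  term_bang : forall A : C, hom A Z;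
  term_uniq : forall (A : C) (f g : hom A Z), f = g }.

Record is_product (C : category) (A B P : C) (p1 : hom P A) (p2 : hom P B) :=
  IsProduct {
  prod_pair : forall X : C, hom X A -> hom X B -> hom X P;
  prod_pair1 : forall X (f : hom X A) (g : hom X B), prod_pair f g \; p1 = f;
  prod_pair2 : forall X (f : hom X A) (g : hom X B), prod_pair f g \; p2 = g;
  prod_uniq : forall X (u v : hom X P),
    u \; p1 = v \; p1 -> u \; p2 = v \; p2 -> u = v }.

Record is_pullback (C : category) (A B D P : C) (f : hom A D) (g : hom B D)
    (p1 : hom P A) (p2 : hom P B) := IsPullback {
  pb_comm : p1 \; f = p2 \; g;
  pb_lift : forall (X : C) (a : hom X A) (b : hom X B),
    a \; f = b \; g -> hom X P;
  pb_lift1 : forall X (a : hom X A) (b : hom X B) (h : a \; f = b \; g),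
    pb_lift h \; p1 = a;
  pb_lift2 : forall X (a : hom X A) (b : hom X B) (h : a \; f = b \; g),
    pb_lift h \; p2 = b;
  pb_uniq : forall X (u v : hom X P),
    u \; p1 = v \; p1 -> u \; p2 = v \; p2 -> u = v }.

(* [P] is the [n]-fold pullback of [q : E -> M] along itself, with projections
   [pr i : P -> E] and structure map [b : P -> M].  The map [b] is determined
   by the [pr i] as soon as [0 < n]; for [n = 0] the condition says that [b] is
   an isomorphism. *)
Record fibre_power (C : category) (E M : C) (q : hom E M) (n : nat)
    (P : C) (b : hom P M) (pr : 'I_n -> hom P E) := FibrePower {
  fp_comm : forall i, pr i \; q = b;
  fp_lift : forall (X : C) (x : hom X M) (f : 'I_n -> hom X E),
    (forall i, f i \; q = x) -> hom X P;
  fp_lift_base : forall X (x : hom X M) (f : 'I_n -> hom X E)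
    (h : forall i, f i \; q = x), fp_lift h \; b = x;
  fp_lift_pr : forall X (x : hom X M) (f : 'I_n -> hom X E)
    (h : forall i, f i \; q = x) (i : 'I_n), fp_lift h \; pr i = f i;
  fp_uniq : forall X (u v : hom X P), u \; b = v \; b ->
    (forall i, u \; pr i = v \; pr i) -> u = v }.

(* The two projections of a 2-fold pullback are indexed by [idx1] and [idx2]. *)
Notation idx1 := (@ord0 1).
Notation idx2 := (@ord_max 1).

Section Pair2.
Variables (C : category) (E M : C) (q : hom E M) (P : C) (b : hom P M).
Variables (pr : 'I_2 -> hom P E) (fp : fibre_power q b pr).
Variables (X : C) (f g : hom X E).

Definition fam2 (i : 'I_2) : hom X E := if i == idx1 then f else g.

Lemma fam2_comm : f \; q = g \; q -> forall i, fam2 i \; q = f \; q.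
Proof. by move=> h i; rewrite /fam2; case: ifP. Qed.

Definition pair2 (h : f \; q = g \; q) : hom X P := fp_lift fp (fam2_comm h).

Lemma pair2_pr1 (h : f \; q = g \; q) : pair2 h \; pr idx1 = f.
Proof. exact: fp_lift_pr. Qed.

Lemma pair2_pr2 (h : f \; q = g \; q) : pair2 h \; pr idx2 = g.
Proof. exact: fp_lift_pr. Qed.

Lemma pair2_base1 (h : f \; q = g \; q) : pair2 h \; b = f \; q.
Proof. exact: fp_lift_base. Qed.

Lemma pair2_base2 (h : f \; q = g \; q) : pair2 h \; b = g \; q.
Proof. by rewrite pair2_base1. Qed.

End Pair2.

(* A bundle over [M] with chosen fibre powers, a zero section and a fibrewise
   binary operation. *)
Record bundle (C : category) (M E : C) := Bundle {
  b_proj : hom E M;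
  b_pow : nat -> C;
  b_base : forall n, hom (b_pow n) M;
  b_pr : forall n, 'I_n -> hom (b_pow n) E;
  b_powP : forall n, fibre_power b_proj (b_base n) (@b_pr n);
  b_zero : hom M E;
  b_add : hom (b_pow 2) E;
  b_zero_proj : b_zero \; b_proj = idm M;
  b_add_proj : b_add \; b_proj = b_base 2 }.

Section AdditiveBundle.
Variables (C : category) (M E : C) (B : bundle M E).
Local Notation q := (b_proj B).

Lemma b_pr_comm n (i j : 'I_n) : b_pr B i \; q = b_pr B j \; q.
Proof. by rewrite !(fp_comm (b_powP B n)). Qed.

(* [b_sum h] is [<f, g> + ], the fibrewise sum of [f] and [g]. *)
Definition b_sum (X : C) (f g : hom X E) (h : f \; q = g \; q) : hom X E :=
  pair2 (b_powP B 2) h \; b_add B.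

Lemma b_sum_proj1 (X : C) (f g : hom X E) (h : f \; q = g \; q) :
  b_sum h \; q = f \; q.
Proof. by rewrite /b_sum -compmA b_add_proj pair2_base1. Qed.

Lemma b_zero_comm : (q \; b_zero B) \; q = idm E \; q.
Proof. by rewrite -compmA b_zero_proj compm1r compm1l. Qed.

Local Notation x := (b_pr B (@Ordinal 3 0 isT)).
Local Notation y := (b_pr B (@Ordinal 3 1 isT)).
Local Notation z := (b_pr B (@Ordinal 3 2 isT)).

Lemma b_sum_comml : b_sum (b_pr_comm _ _ : x \; q = y \; q) \; q = z \; q.
Proof. by rewrite b_sum_proj1; apply: b_pr_comm. Qed.

Lemma b_sum_commr : x \; q = b_sum (b_pr_comm _ _ : y \; q = z \; q) \; q.
Proof. by rewrite b_sum_proj1; apply: b_pr_comm. Qed.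

(* The bundle is a commutative monoid in the slice over [M]. *)
Record is_additive : Prop := IsAdditive {
  add_zero : b_sum b_zero_comm = idm E;
  add_comm :
    b_sum (b_pr_comm _ _ : b_pr B idx2 \; q = b_pr B idx1 \; q) = b_add B;
  add_assoc : b_sum b_sum_comml = b_sum b_sum_commr }.

End AdditiveBundle.

Lemma bundle_map_comm (C : category) (M E M' E' : C) (B : bundle M E)
    (B' : bundle M' E') (f : hom M M') (g : hom E E') :
  g \; b_proj B' = b_proj B \; f ->
  (b_pr B idx1 \; g) \; b_proj B' = (b_pr B idx2 \; g) \; b_proj B'.
Proof.
by move=> h; rewrite -!compmA h !compmA (b_pr_comm B idx1 idx2).
Qed.

Record additive_morphism (C : category) (M E M' E' : C) (B : bundle M E)
    (B' : bundle M' E') (f : hom M M') (g : hom E E') : Prop :=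
  AdditiveMorphism {
  am_proj : g \; b_proj B' = b_proj B \; f;
  am_zero : b_zero B \; g = f \; b_zero B';
  am_add : b_add B \; g = b_sum (bundle_map_comm am_proj) }.

(* The endofunctor [T], the projection [p : T => id], and the [n]-fold
   pullbacks [T_n M] of [p_M] along itself, preserved by every [T^k]
   (the case [k = 0] being the pullback property itself). *)
Record tangent_projection (C : category) := TangentProjection {
  tp_T :> functor C C;
  tp_p : nat_trans tp_T (id_functor C);
  tp_pow : nat -> C -> C;
  tp_base : forall n M, hom (tp_pow n M) M;
  tp_pr : forall n M, 'I_n -> hom (tp_pow n M) (tp_T M);
  tp_powP : forall n k M, fibre_power
    (fmap (iter_functor tp_T k) (tp_p M : hom (tp_T M) M))
    (fmap (iter_functor tp_T k) (tp_base n M))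
    (fun i : 'I_n => fmap (iter_functor tp_T k) (tp_pr M i)) }.

Section TnFunctor.
Variables (C : category) (T : tangent_projection C) (n : nat).

Lemma Tn_map_comm (M N : C) (f : hom M N) (i : 'I_n) :
  (tp_pr T M i \; fmap T f) \; tp_p T N = tp_base T n M \; f.
Proof.
rewrite -compmA (naturality (tp_p T)) compmA; congr (_ \; _).
exact: (fp_comm (tp_powP T n 0 M)).
Qed.

Definition Tn_map (M N : C) (f : hom M N) : hom (tp_pow T n M) (tp_pow T n N) :=
  fp_lift (tp_powP T n 0 N) (Tn_map_comm f).

Lemma Tn_map_base (M N : C) (f : hom M N) :
  Tn_map f \; tp_base T n N = tp_base T n M \; f.
Proof. exact: (fp_lift_base (tp_powP T n 0 N)). Qed.

Lemma Tn_map_pr (M N : C) (f : hom M N) (i : 'I_n) :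
  Tn_map f \; tp_pr T N i = tp_pr T M i \; fmap T f.
Proof. exact: (fp_lift_pr (tp_powP T n 0 N)). Qed.

Lemma Tn_map1 (M : C) : Tn_map (idm M) = idm (tp_pow T n M).
Proof.
apply: (fp_uniq (tp_powP T n 0 M)) => /= [|i].
  by rewrite Tn_map_base compm1r compm1l.
by rewrite Tn_map_pr fmap1 compm1r compm1l.
Qed.

Lemma Tn_mapM (M N Q : C) (f : hom M N) (g : hom N Q) :
  Tn_map (f \; g) = Tn_map f \; Tn_map g.
Proof.
apply: (fp_uniq (tp_powP T n 0 Q)) => /= [|i].
  by rewrite Tn_map_base -compmA Tn_map_base !compmA Tn_map_base.
by rewrite Tn_map_pr -compmA Tn_map_pr fmapM !compmA Tn_map_pr.
Qed.

Definition Tn_functor : functor C C := Functor Tn_map1 Tn_mapM.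

End TnFunctor.

(* Adds the zero section and the sum, as maps over [M]. *)
Record pre_tangent (C : category) := PreTangent {
  pt_proj :> tangent_projection C;
  pt_z : nat_trans (id_functor C) pt_proj;
  pt_s : nat_trans (Tn_functor pt_proj 2) pt_proj;
  pt_z_proj : forall M : C, pt_z M \; tp_p pt_proj M = idm M;
  pt_s_proj : forall M : C, pt_s M \; tp_p pt_proj M = tp_base pt_proj 2 M }.

Section PreTangent.
Variables (C : category) (T : pre_tangent C).

Definition p_ (M : C) : hom (T M) M := tp_p T M.
Definition z_ (M : C) : hom M (T M) := pt_z T M.
Definition s_ (M : C) : hom (tp_pow T 2 M) (T M) := pt_s T M.

Lemma fmap_z_proj (M : C) : fmap T (z_ M) \; fmap T (p_ M) = idm (T M).
Proof. by rewrite -fmapM /z_ /p_ pt_z_proj fmap1. Qed.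

Lemma fmap_s_proj (M : C) :
  fmap T (s_ M) \; fmap T (p_ M) = fmap T (tp_base T 2 M).
Proof. by rewrite -fmapM /s_ /p_ pt_s_proj. Qed.

Definition p_bundle (M : C) : bundle M (T M) :=
  @Bundle C M (T M) (p_ M) (fun n => tp_pow T n M) (fun n => tp_base T n M)
    (fun n i => tp_pr T M i) (fun n => tp_powP T n 0 M) (z_ M) (s_ M)
    (pt_z_proj T M) (pt_s_proj T M).

Definition Tp_bundle (M : C) : bundle (T M) (T (T M)) :=
  @Bundle C (T M) (T (T M)) (fmap T (p_ M)) (fun n => T (tp_pow T n M))
    (fun n => fmap T (tp_base T n M)) (fun n i => fmap T (tp_pr T M i))
    (fun n => tp_powP T n 1 M) (fmap T (z_ M)) (fmap T (s_ M))
    (fmap_z_proj M) (fmap_s_proj M).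

Section Xi.
Variables (M : C) (l : hom (T M) (T (T M))).
Hypothesis l_add : additive_morphism (p_bundle M) (Tp_bundle M) (z_ M) l.

Lemma xi_comm :
  (tp_pr T M idx1 \; z_ (T M)) \; fmap T (p_ M) =
  (tp_pr T M idx2 \; l) \; fmap T (p_ M).
Proof.
have zp : z_ (T M) \; fmap T (p_ M) = p_ M \; z_ M.
  exact/esym/(naturality (pt_z T)).
have lp : l \; fmap T (p_ M) = p_ M \; z_ M := am_proj l_add.
rewrite -!compmA zp lp !compmA; congr (_ \; _).
exact: (b_pr_comm (p_bundle M) idx1 idx2).
Qed.

(* xi_M = (z_{TM} x l_M) Ts_M : T_2 M -> TTM, where z_{TM} x l_M lands in
   T(T_2 M), the pullback of Tp_M along itself. *)
Definition xi : hom (tp_pow T 2 M) (T (T M)) :=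
  pair2 (tp_powP T 2 1 M) xi_comm \; fmap T (s_ M).

End Xi.

End PreTangent.

Record tangent_structure (C : category) := TangentStructure {
  ts_pre :> pre_tangent C;
  ts_l : nat_trans ts_pre (comp_functor ts_pre ts_pre);
  ts_c : nat_trans (comp_functor ts_pre ts_pre) (comp_functor ts_pre ts_pre);
  ts_additive : forall M : C, is_additive (p_bundle ts_pre M);
  ts_l_additive : forall M : C,
    additive_morphism (p_bundle ts_pre M) (Tp_bundle ts_pre M)
      (z_ ts_pre M) (ts_l M);
  ts_c_additive : forall M : C,
    additive_morphism (p_bundle ts_pre (ts_pre M)) (Tp_bundle ts_pre M)
      (idm (ts_pre M)) (ts_c M);
  ts_ll : forall M : C,
    ts_l M \; fmap ts_pre (ts_l M) = ts_l M \; ts_l (ts_pre M);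
  ts_cc : forall M : C, ts_c M \; ts_c M = idm (ts_pre (ts_pre M));
  ts_ccc : forall M : C,
    (fmap ts_pre (ts_c M) \; ts_c (ts_pre M)) \; fmap ts_pre (ts_c M) =
    (ts_c (ts_pre M) \; fmap ts_pre (ts_c M)) \; ts_c (ts_pre M);
  ts_lc : forall M : C, ts_l M \; ts_c M = ts_l M;
  ts_lcc : forall M : C,
    (ts_l (ts_pre M) \; fmap ts_pre (ts_c M)) \; ts_c (ts_pre M) =
    ts_c M \; fmap ts_pre (ts_l M);
  ts_universal : forall M : C,
    is_pullback (fmap ts_pre (p_ ts_pre M)) (z_ ts_pre M)
      (xi (ts_l_additive M)) (tp_pr ts_pre M idx1 \; p_ ts_pre M) }.

Record cartesian (C : category) := Cartesian {
  one : C;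
  one_terminal : is_terminal one;
  times : C -> C -> C;
  pi1 : forall A B, hom (times A B) A;
  pi2 : forall A B, hom (times A B) B;
  times_product : forall A B, is_product (pi1 A B) (pi2 A B) }.

Arguments one {C c}.
Arguments times {C c} A B.
Arguments pi1 {C c A B}.
Arguments pi2 {C c A B}.

Record cartesian_tangent_category := CartesianTangentCategory {
  ct_cat :> category;
  ct_tangent : tangent_structure ct_cat;
  ct_cart : cartesian ct_cat;
  ct_T_one : is_terminal (ct_tangent (@one _ ct_cart));
  ct_T_times : forall A B : ct_cat,
    is_product (fmap ct_tangent (@pi1 _ ct_cart A B))
      (fmap ct_tangent (@pi2 _ ct_cart A B)) }.

Section CartesianOps.
Variable X : cartesian_tangent_category.

Definition Tan : tangent_structure X := ct_tangent X.
Definition unit_obj : X := @one X (ct_cart X).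
Definition tprod (A B : X) : X := @times X (ct_cart X) A B.
Definition prj1 (A B : X) : hom (tprod A B) A := pi1.
Definition prj2 (A B : X) : hom (tprod A B) B := pi2.
Definition bang (A : X) : hom A unit_obj :=
  term_bang (one_terminal (ct_cart X)) A.
Definition pairing (D A B : X) (f : hom D A) (g : hom D B) :
  hom D (tprod A B) := prod_pair (times_product (ct_cart X) A B) f g.
Definition times_map (A B A' B' : X) (f : hom A A') (g : hom B B') :
  hom (tprod A B) (tprod A' B') :=
  pairing (prj1 A B \; f) (prj2 A B \; g).
Definition times_assoc (A B D : X) :
  hom (tprod (tprod A B) D) (tprod A (tprod B D)) :=
  pairing (prj1 _ D \; prj1 A B) (times_map (prj2 A B) (idm D)).

(* The identification TA x TB = T(A x B), i.e. the inverse of <Tpi1, Tpi2>. *)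
Definition T_times_iso (A B : X) :
  hom (tprod (Tan A) (Tan B)) (Tan (tprod A B)) :=
  prod_pair (ct_T_times A B) (prj1 (Tan A) (Tan B)) (prj2 (Tan A) (Tan B)).

End CartesianOps.

Record group_object (X : cartesian_tangent_category) := GroupObject {
  grp :> X;
  grp_e : hom (unit_obj X) grp;
  grp_m : hom (tprod grp grp) grp;
  grp_i : hom grp grp;
  grp_assoc : times_map grp_m (idm grp) \; grp_m =
    times_assoc grp grp grp \; (times_map (idm grp) grp_m \; grp_m);
  grp_unitl : pairing (bang grp \; grp_e) (idm grp) \; grp_m = idm grp;
  grp_unitr : pairing (idm grp) (bang grp \; grp_e) \; grp_m = idm grp;
  grp_invl : pairing grp_i (idm grp) \; grp_m = bang grp \; grp_e;
  grp_invr : pairing (idm grp) grp_i \; grp_m = bang grp \; grp_e }.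

(* [tangent_space G] is T_e G, with its two pullback projections; the square
   is a pullback and is preserved by every [T^n] ([n = 0] being the pullback
   property itself). *)
Record lie_group (X : cartesian_tangent_category) := LieGroup {
  lie_grp :> group_object X;
  tangent_space : X;
  tangent_incl : hom tangent_space (Tan X lie_grp);
  tangent_bang : hom tangent_space (unit_obj X);
  tangent_spaceP : forall n : nat, is_pullback
    (fmap (iter_functor (Tan X) n) (p_ (Tan X) lie_grp))
    (fmap (iter_functor (Tan X) n) (grp_e lie_grp))
    (fmap (iter_functor (Tan X) n) tangent_incl)
    (fmap (iter_functor (Tan X) n) tangent_bang) }.

Section LieFunctor.
Variables (X : cartesian_tangent_category) (G : group_object X).

(* [A]-parametrized left-invariant vector fields.  With
   G x G x A := (G x G) x A, the map z_G x V : G x (G x A) -> TG x TG is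
   precomposed with the associativity isomorphism. *)
Record plivf (A : X) := Plivf {
  plivf_map :> hom (tprod G A) (Tan X G);
  plivf_section : plivf_map \; p_ (Tan X) G = prj1 G A;
  plivf_invariant :
    times_map (grp_m G) (idm A) \; plivf_map =
    times_assoc G G A \; (times_map (z_ (Tan X) G) plivf_map \;
      (T_times_iso G G \; fmap (Tan X) (grp_m G))) }.

Lemma plivf_eq (A : X) (V W : plivf A) :
  plivf_map V = plivf_map W -> V = W.
Proof.
case: V W => [V V1 V2] [W W1 W2] /= E; case: W / E W1 W2 => W1 W2.
by rewrite (proof_irrelevance _ V1 W1) (proof_irrelevance _ V2 W2).
Qed.

Lemma pairing1 (D A B : X) (f : hom D A) (g : hom D B) :
  pairing f g \; prj1 A B = f.
Proof. exact: prod_pair1. Qed.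

Lemma pairing2 (D A B : X) (f : hom D A) (g : hom D B) :
  pairing f g \; prj2 A B = g.
Proof. exact: prod_pair2. Qed.

Lemma tprod_uniq (D A B : X) (u v : hom D (tprod A B)) :
  u \; prj1 A B = v \; prj1 A B -> u \; prj2 A B = v \; prj2 A B -> u = v.
Proof. exact: (prod_uniq (times_product (ct_cart X) A B)). Qed.

Lemma pairing_comp (D' D A B : X) (h : hom D' D) (f : hom D A) (g : hom D B) :
  h \; pairing f g = pairing (h \; f) (h \; g).
Proof.
apply: tprod_uniq; first by rewrite -compmA !pairing1.
by rewrite -compmA !pairing2.
Qed.

Lemma pairing_map (D A B A' B' : X) (f : hom D A) (g : hom D B)
    (f' : hom A A') (g' : hom B B') :
  pairing f g \; times_map f' g' = pairing (f \; f') (g \; g').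
Proof. by rewrite pairing_comp !compmA pairing1 pairing2. Qed.

Lemma times_map_comp (A B A' B' A'' B'' : X) (f : hom A A') (g : hom B B')
    (f' : hom A' A'') (g' : hom B' B'') :
  times_map f g \; times_map f' g' = times_map (f \; f') (g \; g').
Proof. by rewrite pairing_map -!compmA. Qed.

Lemma times_map1 (A B : X) : times_map (idm A) (idm B) = idm (tprod A B).
Proof.
by apply: tprod_uniq; rewrite (pairing1, pairing2) compm1r compm1l.
Qed.

Lemma times_assoc_map (A B D D' : X) (f : hom D' D) :
  times_map (idm (tprod A B)) f \; times_assoc A B D =
  times_assoc A B D' \; times_map (idm A) (times_map (idm B) f).
Proof.
rewrite /times_assoc pairing_comp pairing_map compmA pairing1 !compm1r.
by rewrite !times_map_comp !compm1l !compm1r.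
Qed.

Section Reindex.
Variables (A B : X) (f : hom A B) (V : plivf B).
Let W : hom (tprod G A) (Tan X G) := times_map (idm G) f \; V.

Lemma plivf_reindex_section : W \; p_ (Tan X) G = prj1 G A.
Proof. by rewrite -compmA plivf_section pairing1 compm1r. Qed.

Lemma plivf_reindex_invariant :
  times_map (grp_m G) (idm A) \; W =
  times_assoc G G A \; (times_map (z_ (Tan X) G) W \;
    (T_times_iso G G \; fmap (Tan X) (grp_m G))).
Proof.
rewrite /W compmA times_map_comp compm1l compm1r.
have -> : times_map (grp_m G) f =
    times_map (idm (tprod G G)) f \; times_map (grp_m G) (idm B).
  by rewrite times_map_comp compm1l compm1r.
rewrite -compmA plivf_invariant compmA times_assoc_map -compmA; congr (_ \; _).
by rewrite compmA times_map_comp compm1l.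
Qed.

Definition plivf_reindex : plivf A :=
  Plivf plivf_reindex_section plivf_reindex_invariant.

End Reindex.

Let lie_obj (A : op_cat X) : set_cat := plivf A.

Let lie_map (A B : op_cat X) (f : hom A B) : hom (lie_obj A) (lie_obj B) :=
  fun V => plivf_reindex (f : @hom X B A) V.

Lemma lie_functor1 (A : op_cat X) : lie_map (idm A) = idm (lie_obj A).
Proof.
apply: functional_extensionality => V; apply: plivf_eq => /=.
by rewrite times_map1 compm1l.
Qed.

Lemma lie_functorM (A B D : op_cat X) (f : hom A B) (g : hom B D) :
  lie_map (f \; g) = lie_map f \; lie_map g.
Proof.
apply: functional_extensionality => V; apply: plivf_eq => /=.
by rewrite compmA times_map_comp compm1l.
Qed.

Definition lie_functor : presheaf X := Functor lie_functor1 lie_functorM.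

End LieFunctor.

(* Main.v *)
Require Import Defs.
From mathcomp Require Import all_boot.
From Stdlib Require Import FunctionalExtensionality.

Set Implicit Arguments.
Unset Strict Implicit.
Unset Printing Implicit Defensive.

Local Open Scope cat_scope.

(** [TG] is again a group, with multiplication [Tm] and unit [e z_G], and
[z_G : G -> TG] is a homomorphism.  A left-invariant field is determined by its
value at the unit, [V (g, a) = z_G g * V (e, a)], and conversely
[z_G g * v a] is a left-invariant field for every [v : A -> T_e G]. *)

Lemma pairing_T_times_iso (X : cartesian_tangent_category) (D A B : X)
    (f : hom D A) (g : hom D B) :
  pairing (fmap (Tan X) f) (fmap (Tan X) g) \; T_times_iso A B =
  fmap (Tan X) (pairing f g).
Proof.
apply: (prod_uniq (ct_T_times A B)).
  by rewrite -compmA prod_pair1 -fmapM !pairing1.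
by rewrite -compmA prod_pair2 -fmapM !pairing2.
Qed.

Lemma T_times_iso1 (X : cartesian_tangent_category) (A B : X) :
  T_times_iso A B \; fmap (Tan X) (prj1 A B) = prj1 _ _.
Proof. exact: (prod_pair1 (ct_T_times A B)). Qed.

Lemma T_times_iso2 (X : cartesian_tangent_category) (A B : X) :
  T_times_iso A B \; fmap (Tan X) (prj2 A B) = prj2 _ _.
Proof. exact: (prod_pair2 (ct_T_times A B)). Qed.

Lemma bang_uniq (X : cartesian_tangent_category) (A : X)
    (f g : hom A (unit_obj X)) : f = g.
Proof. exact: (term_uniq (one_terminal (ct_cart X))). Qed.

Lemma z_natural (X : cartesian_tangent_category) (A B : X) (f : hom A B) :
  z_ (Tan X) A \; fmap (Tan X) f = f \; z_ (Tan X) B.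
Proof. exact/esym/(naturality (pt_z (Tan X))). Qed.

Lemma p_natural (X : cartesian_tangent_category) (A B : X) (f : hom A B) :
  fmap (Tan X) f \; p_ (Tan X) B = p_ (Tan X) A \; f.
Proof. exact: (naturality (tp_p (Tan X))). Qed.

Lemma z_p (X : cartesian_tangent_category) (A : X) :
  z_ (Tan X) A \; p_ (Tan X) A = idm A.
Proof. exact: (pt_z_proj (Tan X)). Qed.

Section TangentGroup.
Variables (X : cartesian_tangent_category) (G : group_object X).
Local Notation T := (Tan X).
Local Notation z := (z_ T G).
Local Notation p := (p_ T G).

Definition tangent_mul : hom (tprod (T G) (T G)) (T G) :=
  T_times_iso G G \; fmap T (grp_m G).

Local Notation mul f g := (pairing f g \; tangent_mul).

(** Naturality of [p] at [grp_m]: the projection [TG -> G] is a homomorphism, which later makes left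
    translates sections. *)
Lemma tangent_mul_p : tangent_mul \; p = times_map p p \; grp_m G.
Proof.
rewrite /tangent_mul -compmA p_natural compmA; congr (_ \; _).
by apply: tprod_uniq; rewrite -compmA -p_natural compmA
  ?(T_times_iso1, T_times_iso2) ?(pairing1, pairing2).
Qed.

(** Naturality of [z] at [grp_m]: the zero section is a homomorphism, the source of left
    invariance. *)
Lemma tangent_mul_z (D : X) (f g : hom D G) :
  mul (f \; z) (g \; z) = (pairing f g \; grp_m G) \; z.
Proof.
rewrite -pairing_map -[RHS]compmA -z_natural /tangent_mul !compmA.
congr (_ \; _); rewrite -!compmA; congr (_ \; _).
(* It remains to identify [z x z] with the zero section of [G x G]; as [T] preserves products, the
   images of the projections detect this. *)
apply: (prod_uniq (ct_T_times G G)).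
  by rewrite -compmA [_ \; fmap _ _]T_times_iso1 pairing1 [RHS]z_natural.
by rewrite -compmA [_ \; fmap _ _]T_times_iso2 pairing2 [RHS]z_natural.
Qed.

(** Transfers identities from [G] to [TG]: products of maps with a common factor [w] are computed
    inside [G]. *)
Lemma tangent_mul_T (D E : X) (w : hom D (T E)) (f g : hom E G) :
  mul (w \; fmap T f) (w \; fmap T g) = w \; fmap T (pairing f g \; grp_m G).
Proof.
by rewrite fmapM -pairing_T_times_iso -pairing_comp /tangent_mul !compmA.
Qed.

Lemma grp_mulA (D : X) (f g h : hom D G) :
  pairing (pairing f g \; grp_m G) h \; grp_m G =
  pairing f (pairing g h \; grp_m G) \; grp_m G.
Proof.
have := congr1 (compm (pairing (pairing f g) h)) (grp_assoc G).
rewrite !compmA pairing_map compm1r => ->; congr (_ \; _).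
rewrite /times_assoc pairing_comp pairing_map !compmA !pairing1 compm1r.
congr (pairing _ (_ \; _)).
by rewrite /times_map pairing_comp !compmA pairing1 !pairing2 compm1r.
Qed.

(* Every triple of maps into [TG] factors through [T] of the triple of
projections [G x G x G -> G], so that associativity is the image of that of
[G]. *)
Lemma tangent_mulA (D : X) (f g h : hom D (T G)) :
  mul (mul f g) h = mul f (mul g h).
Proof.
pose w := pairing (pairing f g \; T_times_iso G G) h \;
  T_times_iso (tprod G G) G.
have wf : w \; fmap T (prj1 (tprod G G) G \; prj1 G G) = f.
  rewrite fmapM !compmA -(compmA _ (T_times_iso _ _)) T_times_iso1 pairing1.
  by rewrite -compmA T_times_iso1 pairing1.
have wg : w \; fmap T (prj1 (tprod G G) G \; prj2 G G) = g.
  rewrite fmapM !compmA -(compmA _ (T_times_iso _ _)) T_times_iso1 pairing1.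
  by rewrite -compmA T_times_iso2 pairing2.
have wh : w \; fmap T (prj2 (tprod G G) G) = h.
  by rewrite -compmA T_times_iso2 pairing2.
rewrite -wf -wg -wh.
by rewrite !tangent_mul_T grp_mulA.
Qed.

(** Preservation of the terminal object, with naturality of [z] at [e], identifies the unit of [TG]
    as [e z_G]. *)
Lemma T_bang_unit : fmap T (bang G \; grp_e G) = bang (T G) \; (grp_e G \; z).
Proof.
rewrite fmapM -z_natural compmA; congr (_ \; _).
exact: (term_uniq (ct_T_one X)).
Qed.

(** The image under [T] of the left unit law of [G], precomposed with [f]. *)
Lemma tangent_mul1l (D : X) (f : hom D (T G)) :
  mul ((bang D \; grp_e G) \; z) f = f.
Proof.
have E := congr1 (fmap T) (grp_unitl G).
rewrite fmapM -pairing_T_times_iso T_bang_unit !fmap1 -compmA in E.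
have {}E := congr1 (compm f) E.
rewrite compmA pairing_comp compm1r !compmA in E.
by rewrite (bang_uniq (bang D) (f \; bang (T G))) !compmA E.
Qed.

End TangentGroup.

Section Representation.
Variables (X : cartesian_tangent_category) (G : lie_group X).
Local Notation T := (Tan X).
Local Notation z := (z_ T G).
Local Notation p := (p_ T G).
Local Notation TeG := (tangent_space G).
Local Notation incl := (tangent_incl G).

(** [iter_functor T 0] is the identity functor, so this is the defining square by conversion. *)
Let TeGP : is_pullback p (grp_e G) incl (tangent_bang G) := tangent_spaceP G 0.

Lemma tangent_incl_p (A : X) (v : hom A TeG) :
  (v \; incl) \; p = bang A \; grp_e G.
Proof.
rewrite -compmA (pb_comm TeGP) compmA; congr (_ \; _); exact: bang_uniq.
Qed.

(** The other pullback projection lands in the terminal object, so [incl] alone separates maps. *)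
Lemma tangent_incl_inj (A : X) (u v : hom A TeG) :
  u \; incl = v \; incl -> u = v.
Proof. by move/(pb_uniq TeGP); apply; apply: bang_uniq. Qed.

Definition at_unit (A : X) : hom A (tprod G A) :=
  pairing (bang A \; grp_e G) (idm A).

Lemma at_unit_natural (A B : X) (f : hom A B) :
  at_unit A \; times_map (idm G) f = f \; at_unit B.
Proof.
rewrite pairing_map pairing_comp compm1l !compm1r compmA.
congr (pairing (_ \; _) _); exact: bang_uniq.
Qed.

(** As [V] is a section of [p], the vector [V (e, a)] lies over [e], so it lifts to [T_e G]. *)
Lemma plivf_at_unit_comm (A : X) (V : plivf G A) :
  (at_unit A \; V) \; p = bang A \; grp_e G.
Proof. by rewrite -compmA plivf_section pairing1. Qed.

Definition plivf_at_unit (A : X) (V : plivf G A) : hom A TeG :=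
  pb_lift TeGP (plivf_at_unit_comm V).

Lemma plivf_at_unitE (A : X) (V : plivf G A) :
  plivf_at_unit V \; incl = at_unit A \; V.
Proof. exact: pb_lift1. Qed.

Section LeftTranslate.
Variables (A : X) (v : hom A TeG).
Let W : hom (tprod G A) (T G) := times_map z (v \; incl) \; tangent_mul G.

(** Since [p] is a homomorphism and [v a] lies over [e], the product [z g * v a] lies over
    [g * e = g]. *)
Lemma left_translate_section : W \; p = prj1 G A.
Proof.
rewrite -compmA tangent_mul_p compmA times_map_comp z_p tangent_incl_p.
have -> : times_map (idm G) (bang A \; grp_e G) =
    prj1 G A \; pairing (idm G) (bang G \; grp_e G).
  rewrite /times_map pairing_comp !compm1r !compmA.
  congr (pairing _ (_ \; _)); exact: bang_uniq.
by rewrite -compmA grp_unitr compm1r.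
Qed.

(** Associativity in [TG] and multiplicativity of [z] give [z g * (z h * v a) = z (g h) * v a]. *)
Lemma left_translate_invariant :
  times_map (grp_m G) (idm A) \; W =
  times_assoc G G A \; (times_map z W \;
    (T_times_iso G G \; fmap T (grp_m G))).
Proof.
rewrite -/(tangent_mul G) /W compmA times_map_comp compm1l [RHS]compmA.
rewrite /times_assoc pairing_map (compmA _ _ (tangent_mul G)) times_map_comp.
rewrite compm1l /times_map -tangent_mulA (compmA _ (prj2 G G) z).
rewrite tangent_mul_z -pairing_comp.
have -> : pairing (prj1 G G) (prj2 G G) = idm (tprod G G).
  by apply: tprod_uniq; rewrite (pairing1, pairing2) compm1l.
by rewrite compm1r (compmA _ _ z).
Qed.

Definition left_translate : plivf G A :=
  Plivf left_translate_section left_translate_invariant.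

End LeftTranslate.

(** At the unit the translate is [z e * v a], and [z e] is the unit of [TG]. *)
Lemma left_translateK (A : X) (v : hom A TeG) :
  plivf_at_unit (left_translate v) = v.
Proof.
apply: tangent_incl_inj; rewrite plivf_at_unitE /= compmA pairing_map compm1l.
exact: tangent_mul1l.
Qed.

Lemma plivf_at_unitK (A : X) (V : plivf G A) :
  left_translate (plivf_at_unit V) = V.
Proof.
apply: plivf_eq => /=; rewrite plivf_at_unitE.
(* Left invariance evaluated at [(g, e, a)]. *)
have := congr1 (compm (times_map (pairing (idm G) (bang G \; grp_e G)) (idm A)))
  (plivf_invariant V).
rewrite compmA times_map_comp grp_unitr compm1r times_map1 compm1l => E; rewrite [RHS]E {E}.
rewrite -/(tangent_mul G) !(compmA _ _ (tangent_mul G)); congr (_ \; _).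
rewrite /times_assoc pairing_map pairing_comp {1}/times_map.
(* Both factors are compared separately: [z g] first, then [V (e, a)]. *)
congr pairing; rewrite !compmA.
  by rewrite pairing1 -(compmA _ _ (prj1 G G)) pairing1 compm1r.
rewrite times_map_comp compm1l; congr (_ \; _).
rewrite /at_unit pairing_comp /times_map pairing2 !compmA compm1r.
congr (pairing (_ \; _) _); exact: bang_uniq.
Qed.

(** Both composites send [V] to [b |-> V (e, f b)], where [f] is read as a map from [B] to [A] in
    [X]. *)
Lemma plivf_at_unit_natural (A B : op_cat X) (f : hom A B) :
  fmap (lie_functor G) f \; (@plivf_at_unit B : @hom set_cat _ _) =
  (@plivf_at_unit A : @hom set_cat _ _) \; fmap (hom_presheaf TeG) f.
Proof.
apply: functional_extensionality => V; apply: tangent_incl_inj.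
rewrite plivf_at_unitE /= compmA at_unit_natural.
by rewrite -[RHS](@compmA X) plivf_at_unitE (@compmA X).
Qed.

Definition plivf_at_unit_trans :
    nat_trans (lie_functor G) (hom_presheaf TeG) :=
  @NatTrans _ _ (lie_functor G) (hom_presheaf TeG) plivf_at_unit
    plivf_at_unit_natural.

Lemma plivf_at_unit_iso (A : op_cat X) : is_iso (plivf_at_unit_trans A).
Proof.
exists (@left_translate A); split; apply: functional_extensionality => V.
  exact: plivf_at_unitK.
exact: left_translateK.
Qed.

End Representation.

Theorem proposition4p1 (X : cartesian_tangent_category) (G : lie_group X) :
  representable (lie_functor G) /\
  represented_by (lie_functor G) (tangent_space G).
Proof.
have H : represented_by (lie_functor G) (tangent_space G).
  by constructor; exact: NatIso (@plivf_at_unit_iso X G).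
by split; first exists (tangent_space G).
Qed.
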